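(* Let $n\geq 2$ and let $t$ be an indeterminate. The representation $\eta_1:T_n\rightarrow\mathrm{GL}_n(\mathbb{Z}[t^{\pm1}])$ of the twin group $T_n$ given, for $1\leq i\leq n-1$, by $$\eta_1(s_i)=\left(\begin{array}{c|c|c} I_{i-1} & 0 & 0\\ \hline 0 & \begin{matrix}1-t & t\\ 2-t & t-1\end{matrix} & 0\\ \hline 0&0&I_{n-i-1}\end{array}\right)$$ is reducible.
   Context: For $n\geq 2$, the twin group $T_n$ is the group with generators $s_1,\ldots,s_{n-1}$ and defining relations $s_i^2=1$ for $1\leq i\leq n-1$, and $s_is_j=s_js_i$ for $|i-j|\geq 2$. $I_r$ is the $r\times r$ identity matrix. Matrices act on column vectors. A representation into $\mathrm{GL}_n(\mathbb{Z}[t^{\pm1}])$ is called reducible if, acting on $\mathbb{Q}(t)^n$, it has an invariant subspace that is neither $0$ nor the whole space. *)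

(* Defs.v *)
From HB Require Import structures.
From mathcomp Require Import all_boot all_order all_algebra.
From mathcomp Require Import boolp.

Set Implicit Arguments.
Unset Strict Implicit.
Unset Printing Implicit Defensive.

Import GRing.Theory.
Local Open Scope ring_scope.

Section PresentedGroup.
Variable X : choiceType.

(* A letter (x, b) stands for x if b = false and for x^-1 if b = true. *)
Definition word := seq (X * bool).

Definition winv (w : word) : word := rev [seq (l.1, ~~ l.2) | l <- w].

(* A relation u = v is the pair (u, v); R is the set of defining relations. *)
Variable R : word -> word -> Prop.

(* The least group congruence on words that contains R. *)
Inductive word_cong : word -> word -> Prop :=
| WordRefl u : word_cong u u
| WordSym u v : word_cong u v -> word_cong v u
| WordTrans v u w : word_cong u v -> word_cong v w -> word_cong u w
| WordCat u v u' v' : word_cong u v -> word_cong u' v' ->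
    word_cong (u ++ u') (v ++ v')
| WordCancel x b : word_cong [:: (x, b); (x, ~~ b)] [::]
| WordRel u v : R u v -> word_cong u v.

Definition word_eqb (u v : word) : bool := `[< word_cong u v >].

Fact word_eqb_refl : reflexive word_eqb.
Proof. by move=> u; apply/asboolP/WordRefl. Qed.

Fact word_eqb_sym : symmetric word_eqb.
Proof. by move=> u v; apply/asboolP/asboolP; apply: WordSym. Qed.

Fact word_eqb_trans : transitive word_eqb.
Proof.
move=> v u w /asboolP uv /asboolP vw; apply/asboolP.
exact: WordTrans uv vw.
Qed.

Canonical word_equiv := EquivRel word_eqb word_eqb_refl word_eqb_sym word_eqb_trans.

Local Open Scope quotient_scope.

Definition presented := {eq_quot word_equiv}.

HB.instance Definition _ := Choice.on presented.
HB.instance Definition _ := EqQuotient.on presented.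

Definition pres_one : presented := \pi_presented [::].
Definition pres_mul (x y : presented) : presented :=
  \pi_presented (repr x ++ repr y).
Definition pres_inv (x : presented) : presented :=
  \pi_presented (winv (repr x)).
Definition pres_gen (x : X) : presented := \pi_presented [:: (x, false)].

Lemma pres_eqP (u v : word) :
  \pi_presented u = \pi_presented v <-> word_cong u v.
Proof.
split=> [/eqquotP /asboolP // | uv].
by apply/eqquotP/asboolP.
Qed.

Lemma repr_cong (u : word) : word_cong (repr (\pi_presented u)) u.
Proof. by apply/pres_eqP; rewrite reprK. Qed.

Lemma pres_mulE (u v : word) :
  pres_mul (\pi_presented u) (\pi_presented v) = \pi_presented (u ++ v).
Proof. by apply/pres_eqP; apply: WordCat; apply: repr_cong. Qed.

Lemma winv_cat (u v : word) : winv (u ++ v) = winv v ++ winv u.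
Proof. by rewrite /winv map_cat rev_cat. Qed.

Lemma winvK : involutive winv.
Proof.
move=> u; rewrite /winv map_rev revK -map_comp.
by rewrite (eq_map (g := id)) ?map_id // => -[x b] /=; rewrite negbK.
Qed.

Lemma cat_winv (u : word) : word_cong (u ++ winv u) [::].
Proof.
elim: u => [|[x b] u IH]; first exact: WordRefl.
rewrite -cat1s winv_cat -catA [u ++ _ ++ _]catA.
apply: (@WordTrans ([:: (x, b)] ++ [:: (x, ~~ b)])); last exact: WordCancel.
apply: WordCat; first exact: WordRefl.
rewrite -[X in word_cong _ X]cat0s.
by apply: WordCat; [exact: IH | exact: WordRefl].
Qed.

Lemma winv_cat_self (u : word) : word_cong (winv u ++ u) [::].
Proof. by have := cat_winv (winv u); rewrite winvK. Qed.

Fact pres_mulA : associative pres_mul.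
Proof.
elim/quotW=> u; elim/quotW=> v; elim/quotW=> w.
by rewrite (pres_mulE v w) (pres_mulE u v) !pres_mulE catA.
Qed.

Fact pres_mul1 : left_id pres_one pres_mul.
Proof. by elim/quotW=> u; rewrite pres_mulE. Qed.

Fact pres_mulr1 : right_id pres_one pres_mul.
Proof. by elim/quotW=> u; rewrite pres_mulE cats0. Qed.

Fact pres_mulV : left_inverse pres_one pres_inv pres_mul.
Proof.
move=> x; rewrite -{2}[x]reprK /pres_inv pres_mulE.
by apply/pres_eqP; apply: winv_cat_self.
Qed.

Fact pres_mulrV : right_inverse pres_one pres_inv pres_mul.
Proof.
move=> x; rewrite -{1}[x]reprK /pres_inv pres_mulE.
by apply/pres_eqP; apply: cat_winv.
Qed.

HB.instance Definition _ := isGroup.Build presented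
  pres_mulA pres_mul1 pres_mulr1 pres_mulV pres_mulrV.

End PresentedGroup.

(* The generators s_1, ..., s_(n-1) are indexed from 0 by 'I_n.-1. *)
Section Twin.
Variable n : nat.

Definition twin_letter (i : 'I_n.-1) : 'I_n.-1 * bool := (i, false).

Inductive twin_rel : word 'I_n.-1 -> word 'I_n.-1 -> Prop :=
| TwinSquare i : twin_rel [:: twin_letter i; twin_letter i] [::]
| TwinComm (i j : 'I_n.-1) : (2 <= `|i - j|)%N ->
    twin_rel [:: twin_letter i; twin_letter j]
             [:: twin_letter j; twin_letter i].

Definition twin := presented twin_rel.
HB.instance Definition _ := Group.on twin.

Definition twin_gen (i : 'I_n.-1) : twin := pres_gen twin_rel i.

End Twin.

Section GeneralLinear.
Variables (n : nat) (R : comUnitRingType).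

Record GLn := MkGLn { GLn_mx :> 'M[R]_n; GLn_unit : GLn_mx \in unitmx }.

HB.instance Definition _ := [isSub for GLn_mx].
HB.instance Definition _ := [Choice of GLn by <:].

Definition GLn_one : GLn := MkGLn (unitmx1 R n).

Fact GLn_mul_subproof (A B : GLn) : val A *m val B \in unitmx.
Proof. by rewrite unitmx_mul !GLn_unit. Qed.
Definition GLn_mul (A B : GLn) : GLn := MkGLn (GLn_mul_subproof A B).

Fact GLn_inv_subproof (A : GLn) : invmx (val A) \in unitmx.
Proof. by rewrite unitmx_inv GLn_unit. Qed.
Definition GLn_inv (A : GLn) : GLn := MkGLn (GLn_inv_subproof A).

Fact GLn_mulA : associative GLn_mul.
Proof. by move=> A B C; apply: val_inj; rewrite /= mulmxA. Qed.
Fact GLn_mul1 : left_id GLn_one GLn_mul.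
Proof. by move=> A; apply: val_inj; rewrite /= mul1mx. Qed.
Fact GLn_mulr1 : right_id GLn_one GLn_mul.
Proof. by move=> A; apply: val_inj; rewrite /= mulmx1. Qed.
Fact GLn_mulV : left_inverse GLn_one GLn_inv GLn_mul.
Proof. by move=> A; apply: val_inj; rewrite /= mulVmx ?GLn_unit. Qed.
Fact GLn_mulrV : right_inverse GLn_one GLn_inv GLn_mul.
Proof. by move=> A; apply: val_inj; rewrite /= mulmxV ?GLn_unit. Qed.

HB.instance Definition _ := isGroup.Build GLn
  GLn_mulA GLn_mul1 GLn_mulr1 GLn_mulV GLn_mulrV.

End GeneralLinear.

(* Q(t) is Frac(Q[t]); Z[t, t^-1] is its subring of the fractions p / t ^ k
   with p in Z[t]. *)
Definition Qt := {fraction {poly rat}}.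
HB.instance Definition _ := GRing.Field.on Qt.

Definition intpoly_Qt (p : {poly int}) : Qt := tofrac (map_poly intr p).

Definition Qt_t : Qt := intpoly_Qt 'X.

Definition is_laurent : {pred Qt} :=
  fun x => `[< exists (p : {poly int}) (k : nat), x = intpoly_Qt p / Qt_t ^+ k >].

Lemma intpoly_QtB p q : intpoly_Qt (p - q) = intpoly_Qt p - intpoly_Qt q.
Proof. by rewrite /intpoly_Qt !rmorphB. Qed.

Lemma intpoly_QtM p q : intpoly_Qt (p * q) = intpoly_Qt p * intpoly_Qt q.
Proof. by rewrite /intpoly_Qt !rmorphM. Qed.

Lemma intpoly_QtX p k : intpoly_Qt (p ^+ k) = intpoly_Qt p ^+ k.
Proof. by rewrite /intpoly_Qt !rmorphXn. Qed.

Lemma Qt_t_neq0 : Qt_t != 0.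
Proof. by rewrite /Qt_t /intpoly_Qt map_polyX tofrac_eq0 polyX_eq0. Qed.

Fact is_laurent_subring : subring_closed is_laurent.
Proof.
have t0 k : Qt_t ^+ k != 0 by rewrite expf_neq0 ?Qt_t_neq0.
split.
- apply/asboolP; exists 1, 0%N.
  by rewrite expr0 divr1 /intpoly_Qt !rmorph1.
- move=> x y /asboolP[p [k ->]] /asboolP[q [l ->]]; apply/asboolP.
  exists (p * 'X ^+ l - q * 'X ^+ k), (k + l)%N.
  rewrite intpoly_QtB !intpoly_QtM !intpoly_QtX -/Qt_t exprD.
  by rewrite -mulNr addf_div ?t0 // mulNr.
- move=> x y /asboolP[p [k ->]] /asboolP[q [l ->]]; apply/asboolP.
  exists (p * q), (k + l)%N.
  by rewrite intpoly_QtM exprD mulf_div.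
Qed.

Record laurent := MkLaurent { laurent_Qt : Qt; _ : laurent_Qt \in is_laurent }.

HB.instance Definition _ := [isSub for laurent_Qt].
HB.instance Definition _ := [Choice of laurent by <:].
HB.instance Definition _ :=
  GRing.SubChoice_isSubComNzRing.Build Qt is_laurent laurent is_laurent_subring.

Definition laurent_unit : {pred laurent} :=
  fun x => (val x != 0) && ((val x)^-1 \in is_laurent).
Definition laurent_inv (x : laurent) : laurent :=
  if x \in laurent_unit then insubd x (val x)^-1 else x.

Fact laurent_mulVx : {in laurent_unit, left_inverse 1 laurent_inv *%R}.
Proof.
move=> x Ux; apply: val_inj; rewrite rmorphM rmorph1 /laurent_inv Ux.
by case/andP: Ux => x0 Vx; rewrite /= (insubdK x Vx : laurent_Qt _ = _) mulVf.
Qed.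

Fact laurent_unitPl (x y : laurent) : y * x = 1 -> x \in laurent_unit.
Proof.
move=> yx; have yx1 : val y * val x = 1 by rewrite -rmorphM yx rmorph1.
have x0 : val x != 0.
  by apply: contra_eq_neq yx1 => ->; rewrite mulr0 eq_sym oner_eq0.
apply/andP; split=> //.
by rewrite -[_^-1]mul1r -yx1 mulfK // (valP y).
Qed.

Fact laurent_inv_out : {in [predC laurent_unit], laurent_inv =1 id}.
Proof. by move=> x /negbTE nUx; rewrite /laurent_inv nUx. Qed.

HB.instance Definition _ := GRing.ComNzRing_hasMulInverse.Build laurent
  laurent_mulVx laurent_unitPl laurent_inv_out.

Fact Qt_t_laurent : Qt_t \in is_laurent.
Proof. by apply/asboolP; exists 'X, 0%N; rewrite expr0 divr1. Qed.

Definition laurent_t : laurent := MkLaurent Qt_t_laurent.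

(* Matrices act on column vectors; entries are read in Q(t). *)
Definition reducible (T : groupType) (n : nat)
    (eta : {multiplicative T -> GLn n laurent}) : Prop :=
  exists W : {vspace 'cV[Qt]_n},
    [/\ W != 0%VS, W != fullv
      & forall (g : T) (v : 'cV[Qt]_n), v \in W ->
          map_mx laurent_Qt (eta g) *m v \in W].

(* With i counted from 0, the blocks have sizes i, 2 and n - (i + 2). *)
Fact eta1_size (n : nat) (i : 'I_n.-1) : (i + 2 + (n - (i + 2)) = n)%N.
Proof. by case: n i => [|n] [i] //= lt_in; rewrite subnKC // addn2. Qed.

Definition eta1_block : 'M[laurent]_2 :=
  let t := laurent_t in
  block_mx (1 - t)%:M t%:M (2 - t)%:M (t - 1)%:M : 'M_(1 + 1).

Definition eta1_mx (n : nat) (i : 'I_n.-1) : 'M[laurent]_n :=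
  castmx (eta1_size i, eta1_size i)
    (block_mx (block_mx 1%:M 0 0 eta1_block) 0 0 1%:M
      : 'M_(i + 2 + (n - (i + 2)))).

(* Main.v *)
Require Import Defs.
From HB Require Import structures.
From mathcomp Require Import all_boot all_order all_algebra.
From mathcomp Require Import zify ring.

Set Implicit Arguments.
Unset Strict Implicit.
Unset Printing Implicit Defensive.

(** The matrix of each generator is a rank-one perturbation of the identity:
    writing [e_k] for the standard basis of columns and [e_k^*] for its dual,
    eta1(s_i) = 1 + r_i c_i  with  r_i = (2 - t) e_(i+1) - t e_i
    and  c_i = e_i^* - e_(i+1)^*  ([eta1_mxE]).
    Since c_i r_i = -2, this is a reflection, so it squares to 1; since
    c_i r_j = 0 when i and j are at distance at least 2, distant generators
    commute. These are the relations of the twin group, so the universal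
    property of a presented group ([presented_universal]) yields the
    representation.

    Every row c_i has entries summing to 0, hence all the generators, and
    therefore the whole group, fix the column of ones ([eta1_fixes_ones]). The
    line that it spans is invariant, and it is a proper nonzero subspace
    because n is at least 2 ([fixed_vector_reducible]). *)

(** * Homomorphisms out of a presented group *)

Section MultiplicativeGroups.
Local Open Scope group_scope.
Variables (G H : groupType) (f : {multiplicative G -> H}).

Lemma multiplicative1 : f 1 = 1.
Proof. by apply: (mulgI (f 1)); rewrite -gmulfM !mulg1. Qed.

Lemma multiplicativeV : {morph f : g / g^-1}.
Proof. by move=> g; apply/divg1_eq; rewrite invgK -gmulfM mulVg multiplicative1. Qed.

End MultiplicativeGroups.

Section PresentedGroupTheory.
Local Open Scope group_scope.
Variables (X : choiceType) (R : word X -> word X -> Prop).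

Section Evaluation.
Variables (G : groupType) (f : X -> G).

Definition word_eval (w : word X) : G :=
  foldr (fun l g => (if l.2 then (f l.1)^-1 else f l.1) * g) 1 w.

Lemma word_eval_cat u v : word_eval (u ++ v) = word_eval u * word_eval v.
Proof. by elim: u => [|l u IH] /=; rewrite ?mul1g // IH mulgA. Qed.

Hypothesis f_rel : forall u v, R u v -> word_eval u = word_eval v.

Lemma word_eval_cong u v : word_cong R u v -> word_eval u = word_eval v.
Proof.
elim=> {u v} //.
- by move=> v u w _ -> _ ->.
- by move=> u v u' v' _ IH _ IH'; rewrite !word_eval_cat IH IH'.
- by move=> x [] /=; rewrite mulg1 ?mulVg ?mulgV.
Qed.

(** Evaluating on the canonical representative makes the lift a total function
    on the quotient; [word_eval_cong] says that the choice does not matter. *)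
Definition presented_lift (g : presented R) : G := word_eval (repr g).

Lemma presented_liftM : {morph presented_lift : g h / g * h}.
Proof.
by move=> g h; rewrite -word_eval_cat; apply/word_eval_cong/repr_cong.
Qed.

HB.instance Definition _ :=
  isMultiplicative.Build (presented R) G presented_lift presented_liftM.

(** Von Dyck's theorem: generators may be sent to any elements that satisfy the
    defining relations, because the relation identifying words is the least
    congruence containing these and the free cancellations. *)
Lemma presented_universal :
  exists phi : {multiplicative presented R -> G},
    forall x, phi (pres_gen R x) = f x.
Proof.
exists presented_lift => x.
by rewrite /= /presented_lift (word_eval_cong (repr_cong R _)) /= mulg1.
Qed.

End Evaluation.

(** The generators generate: an induction on a representing word, whose letters
    are generators or their inverses. *)
Lemma presented_ind (P : presented R -> Prop) :
    P 1 -> (forall g h, P g -> P h -> P (g * h)) ->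
    (forall g, P g -> P g^-1) -> (forall x, P (pres_gen R x)) ->
  forall g, P g.
Proof.
move=> P1 PM PV Pgen; elim/quotW; elim=> [|[x b] w Pw]; first exact: P1.
have Px : P (\pi_(presented R)%qT [:: (x, b)]).
  case: b; last exact: Pgen.
  have -> : \pi_(presented R)%qT [:: (x, true)] = (pres_gen R x)^-1.
    apply: (mulIg (pres_gen R x)); rewrite mulVg [LHS]pres_mulE.
    exact/pres_eqP/WordCancel.
  exact/PV/Pgen.
by have := PM _ _ Px Pw; rewrite [_ * _]pres_mulE.
Qed.

End PresentedGroupTheory.

(** * Reflections as rank-one perturbations of the identity *)

Section Representation.
Local Open Scope ring_scope.
Import GRing.Theory.

Section RankOne.
Variables (R : comNzRingType) (n : nat).
Implicit Types (u : 'cV[R]_n) (w : 'rV[R]_n).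

Lemma rank_one_mul u w u' w' :
  (1%:M + u *m w) *m (1%:M + u' *m w') =
    1%:M + u *m w + u' *m w' + (w *m u') 0 0 *: (u *m w').
Proof.
rewrite mulmxDl !mulmxDr !mul1mx mulmx1 mulmxA -(mulmxA u) [w *m u']mx11_scalar.
rewrite mul_mx_scalar -scalemxAl !mxE eqxx mulr1n.
by rewrite !addrA (addrAC 1%:M).
Qed.

(** With [A = u *m w], the square is [1 + 2 A + A ^ 2], and [A ^ 2 = - 2 A]. *)
Lemma reflection_sqr u w : (w *m u) 0 0 = - 2%:R ->
  (1%:M + u *m w) *m (1%:M + u *m w) = 1%:M.
Proof.
move=> wu; rewrite rank_one_mul wu scaleNr scaler_nat mulr2n.
by rewrite -(addrA 1%:M) addrK.
Qed.

Lemma rank_one_comm u w u' w' : w *m u' = 0 -> w' *m u = 0 ->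
  (1%:M + u *m w) *m (1%:M + u' *m w') = (1%:M + u' *m w') *m (1%:M + u *m w).
Proof.
by move=> h h'; rewrite !rank_one_mul h h' !mxE !scale0r !addr0 addrAC.
Qed.

End RankOne.

(** * The representation of the twin group *)

Section Eta1.
Variable n : nat.
Implicit Types i j : 'I_n.-1.

Fact lower_subproof i : (i < n)%N.
Proof. by have := ltn_ord i; lia. Qed.
Fact upper_subproof i : (i.+1 < n)%N.
Proof. by have := ltn_ord i; lia. Qed.
Definition lower i : 'I_n := Ordinal (lower_subproof i).
Definition upper i : 'I_n := Ordinal (upper_subproof i).

Definition root i : 'cV[laurent]_n :=
  (2 - laurent_t) *: delta_mx (upper i) 0 - laurent_t *: delta_mx (lower i) 0.

Definition coroot i : 'rV[laurent]_n :=
  delta_mx 0 (lower i) - delta_mx 0 (upper i).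

Lemma coroot_mulE m i (A : 'M[laurent]_(n, m)) :
  coroot i *m A = row (lower i) A - row (upper i) A.
Proof. by rewrite mulmxBl -!rowE. Qed.

Lemma coroot_root i : (coroot i *m root i) 0 0 = - 2%:R.
Proof.
rewrite coroot_mulE !mxE -!val_eqE /= !eqxx ltn_eqF // gtn_eqF //=.
by rewrite !mulr0 !mulr1 sub0r subr0 opprB addKr.
Qed.

Lemma coroot_root_far i j : (2 <= `|i - j|)%N -> coroot i *m root j = 0.
Proof.
move=> ij; rewrite coroot_mulE; apply/matrixP => a b.
rewrite !mxE -!val_eqE /=.
have -> : (i == j.+1 :> nat) = false by lia.
have -> : (i == j :> nat) = false by lia.
have -> : (i.+1 == j.+1 :> nat) = false by lia.
have -> : (i.+1 == j :> nat) = false by lia.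
by rewrite /= !mulr0 !subr0.
Qed.

(** The nontrivial block minus the identity is [[-t, t], [2 - t, t - 2]], the
    product of the column (-t, 2 - t) and the row (1, -1). *)
Lemma eta1_mxE i : eta1_mx i = 1%:M + root i *m coroot i.
Proof.
apply/matrixP => a b; rewrite castmxE.
rewrite -[a in RHS](cast_ordKV (eta1_size i)) -[b in RHS](cast_ordKV (eta1_size i)).
(* Index both sides by the blocks, so that the entries can be compared there. *)
move: (cast_ord _ a) (cast_ord _ b) => {a b} a b.
rewrite [RHS]mxE [X in _ + X]mxE big_ord1.
case: (split_ordP a) => {}a ->; [case: (split_ordP a) => {}a -> | ];
  (case: (split_ordP b) => {}b ->; [case: (split_ordP b) => {}b -> | ]).
all: rewrite ?(block_mxEul, block_mxEur, block_mxEdl, block_mxEdr).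
all: rewrite !mxE -!val_eqE /= ?(ord1 a) ?(ord1 b).
all: have := ltn_ord a; have := ltn_ord b.
(* The fifth case is the central 2 x 2 block; elsewhere the perturbation is 0. *)
5: { move=> _ _; case: (@split_ordP 1 1 a) => {}a ->; case: (@split_ordP 1 1 b) => {}b ->.
all: rewrite ?(row_mxEl, row_mxEr) (ord1 a) (ord1 b) !mxE /= eqxx.
all: repeat case: eqP => ?; try lia; rewrite /=; ring. }
all: repeat case: eqP => ?; rewrite /=; try lia; move=> _ _; ring.
Qed.

(** The coroot is a difference of two coordinates, hence kills constant
    columns. *)
Lemma eta1_mx_ones i : eta1_mx i *m const_mx 1 = const_mx 1 :> 'cV_n.
Proof.
rewrite eta1_mxE mulmxDl mul1mx -mulmxA coroot_mulE.
by rewrite !row_const subrr mulmx0 addr0.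
Qed.

Lemma eta1_mx_sqr i : eta1_mx i *m eta1_mx i = 1%:M.
Proof. by rewrite eta1_mxE reflection_sqr ?coroot_root. Qed.

Definition eta1_gen i : GLn n laurent := MkGLn (proj1 (mulmx1_unit (eta1_mx_sqr i))).

Lemma eta1_mx_comm i j : (2 <= `|i - j|)%N ->
  eta1_mx i *m eta1_mx j = eta1_mx j *m eta1_mx i.
Proof.
by move=> ij; rewrite !eta1_mxE rank_one_comm // coroot_root_far // distnC.
Qed.

Lemma eta1_exists :
  exists eta : {multiplicative twin n -> GLn n laurent},
    forall i, GLn_mx (eta (twin_gen i)) = eta1_mx i.
Proof.
have [u v|eta etaE] := @presented_universal _ (@twin_rel n) _ eta1_gen.
  case=> [i|i j ij]; apply: val_inj; rewrite /= !mulmx1.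
    exact: eta1_mx_sqr.
  exact: eta1_mx_comm.
by exists eta => i; rewrite etaE.
Qed.

(** [presented_ind], restated so that the unit, product and inverse are those of
    the group structure declared on [twin n]. *)
Lemma twin_ind (P : twin n -> Prop) :
    P 1%g -> (forall g h, P g -> P h -> P (g * h)%g) ->
    (forall g, P g -> P g^-1%g) -> (forall i, P (twin_gen i)) ->
  forall g, P g.
Proof. exact: presented_ind. Qed.

Lemma eta1_fixes_ones (eta : {multiplicative twin n -> GLn n laurent}) :
    (forall i, GLn_mx (eta (twin_gen i)) = eta1_mx i) ->
  forall g, GLn_mx (eta g) *m const_mx 1 = const_mx 1 :> 'cV_n.
Proof.
move=> etaE; elim/twin_ind => [|g h fix_g fix_h|g fix_g|i].
- by rewrite multiplicative1 mul1mx.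
- by rewrite gmulfM /= -mulmxA fix_h.
- by rewrite multiplicativeV /= -{1}fix_g mulKmx // GLn_unit.
- by rewrite etaE eta1_mx_ones.
Qed.

End Eta1.

(** The invariant subspace is the line spanned by the fixed vector: it has
    dimension 1 < n. *)
Lemma fixed_vector_reducible (T : groupType) (n : nat)
    (eta : {multiplicative T -> GLn n laurent}) (v : 'cV[laurent]_n) :
    (2 <= n)%N -> v != 0 -> (forall g, GLn_mx (eta g) *m v = v) ->
  reducible eta.
Proof.
move=> n_ge2 v_neq0 fix_v; pose vQ := map_mx laurent_Qt v.
have vQ_neq0 : vQ != 0.
  apply: contra_neq v_neq0 => /matrixP vQ0; apply/matrixP => i j.
  by apply: val_inj; have := vQ0 i j; rewrite !mxE rmorph0.
have dim_vQ : \dim <[vQ]> = 1%N by rewrite dim_vline vQ_neq0.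
exists <[vQ]>%VS; split.
- by rewrite -dimv_eq0 dim_vQ.
- apply: contraTneq n_ge2 => vQ_full.
  by move: dim_vQ; rewrite vQ_full dimvf /dim /= muln1 => ->.
move=> g w /vlineP[k ->]; apply/vlineP; exists k.
by rewrite -scalemxAr -(map_mxM (\val : laurent -> Qt)) fix_v.
Qed.

End Representation.

Theorem theorem7 (n : nat) (hn : 2 <= n) :
  (exists eta : {multiplicative twin n -> GLn n laurent},
     forall i : 'I_n.-1, GLn_mx (eta (twin_gen i)) = eta1_mx i) /\
  (forall eta : {multiplicative twin n -> GLn n laurent},
     (forall i : 'I_n.-1, GLn_mx (eta (twin_gen i)) = eta1_mx i) ->
     reducible eta).
Proof.
split; first exact: eta1_exists.
move=> eta etaE; apply: fixed_vector_reducible (hn) _ (eta1_fixes_ones etaE).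
case: n hn {eta etaE} => // n _.
by apply/eqP => /matrixP/(_ ord0 ord0); rewrite !mxE => /eqP; rewrite GRing.oner_eq0.
Qed.
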